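(* Suppose $f(a_L+a_H)-f(a_L)\le \frac{f(2a_H)}{2}$. Let $\mathcal{S}$ be the set of all $(w,x)\in\mathbb{R}\times\mathbb{R}^n$ satisfying all of the following linear inequalities: (i) (super-average inequality) $w\ge \sum_{i\in\mathcal{I}_L}\frac{f(2a_L)}{2}x_i+\sum_{i\in\mathcal{I}_H}\frac{f(2a_H)}{2}x_i$; (ii) (lifted-EPIs) for every $l\in\mathcal{I}_L$, $w\ge f(a_L)x_l+\sum_{i\in\mathcal{I}_L\setminus\{l\}}[f(2a_L)-f(a_L)]x_i+\sum_{i\in\mathcal{I}_H}[f(a_L+a_H)-f(a_L)]x_i$; (iii) (lifted-EPIs) for every $h\in\mathcal{I}_H$, $w\ge f(a_H)x_h+\sum_{i\in\mathcal{I}_L}[f(a_L+a_H)-f(a_H)]x_i+\sum_{i\in\mathcal{I}_H\setminus\{h\}}[f(2a_H)-f(a_H)]x_i$; (iv) (lower-SIs) for every $h\in\mathcal{I}_H$, $w\ge\sum_{i\in\mathcal{I}_L}\frac{f(2a_L)}{2}x_i+\left[f(a_L+a_H)-\frac{f(2a_L)}{2}\right]x_h+\sum_{i\in\mathcal{I}_H\setminus\{h\}}\left[f(2a_H)-f(a_L+a_H)+\frac{f(2a_L)}{2}\right]x_i$; (v) (higher-SIs) for every $l\in\mathcal{I}_L$, $w\ge\left[f(a_L+a_H)-\frac{f(2a_H)}{2}\right]x_l+\sum_{i\in\mathcal{I}_L\setminus\{l\}}\left[f(2a_L)-f(a_L+a_H)+\frac{f(2a_H)}{2}\right]x_i+\sum_{i\in\mathcal{I}_H}\frac{f(2a_H)}{2}x_i$;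 (vi) $0\le x_i\le 1$ for all $i\in N$; (vii) $\sum_{i\in N}x_i\le 2$. Then $\mathcal{S}=\mathrm{conv}(\mathcal{P}^2_2)$.
   Context: $N=\{1,\dots,n\}$ is a finite ground set and $f:\mathbb{R}\to\mathbb{R}$ is a concave function with $f(0)=0$. The weight vector $a\in\mathbb{R}^n_+$ has exactly two distinct values $0\le a_L<a_H$; $\mathcal{I}_L=\{i\in N:a_i=a_L\}$ and $\mathcal{I}_H=\{i\in N:a_i=a_H\}$ (both nonempty, partitioning $N$). The mixed-integer set is $\mathcal{P}^2_2=\{(w,x)\in\mathbb{R}\times\{0,1\}^n: w\ge f(\sum_{i=1}^n a_ix_i),\ \sum_{i=1}^n x_i\le 2\}$, and $\mathrm{conv}$ denotes convex hull. *)

(* Defs.v *)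
From mathcomp Require Import all_boot all_order all_algebra.
From mathcomp Require Import all_classical all_reals all_analysis.

Set Implicit Arguments.
Unset Strict Implicit.
Unset Printing Implicit Defensive.

Import Order.TTheory GRing.Theory Num.Theory.

Local Open Scope classical_set_scope.
Local Open Scope ring_scope.

(* [R^o] makes the product with ['rV[R]_n] an [lmodType R]. *)
Definition space (R : realType) (n : nat) : lmodType R :=
  (R^o * 'rV[R]_n)%type.

Definition concave_function (R : realType) (f : R -> R) : Prop :=
  @convex_function R R^o [set: R] (fun t => - f t).

Definition convex_hull (R : realType) (E : lmodType R) (A : set E) : set E :=
  smallest (@convex_set R E) A.

Definition mixed_binary_set (R : realType) (n : nat) (f : R -> R)
    (a : 'rV[R]_n) : set (space R n) :=
  [set wx : space R n | let: (w, x) := wx in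
    [/\ f (\sum_(i < n) a 0 i * x 0 i) <= w,
        forall i, x 0 i = 0 \/ x 0 i = 1
      & \sum_(i < n) x 0 i <= 2] ].

Definition indices_at (R : realType) (n : nat) (a : 'rV[R]_n) (v : R) :
  {set 'I_n} := finset (fun i => a 0 i == v).

Section Inequalities.
Context (R : realType) (n : nat) (f : R -> R) (a : 'rV[R]_n) (aL aH : R).
Context (w : R) (x : 'rV[R]_n).

Let IL := indices_at a aL.
Let IH := indices_at a aH.

Definition super_average : Prop :=
  \sum_(i in IL) f (2 * aL) / 2 * x 0 i
  + \sum_(i in IH) f (2 * aH) / 2 * x 0 i <= w.

Definition lifted_EPI_low (l : 'I_n) : Prop :=
  f aL * x 0 l
  + \sum_(i in IL :\ l) (f (2 * aL) - f aL) * x 0 i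
  + \sum_(i in IH) (f (aL + aH) - f aL) * x 0 i <= w.

Definition lifted_EPI_high (h : 'I_n) : Prop :=
  f aH * x 0 h
  + \sum_(i in IL) (f (aL + aH) - f aH) * x 0 i
  + \sum_(i in IH :\ h) (f (2 * aH) - f aH) * x 0 i <= w.

Definition lower_SI (h : 'I_n) : Prop :=
  \sum_(i in IL) f (2 * aL) / 2 * x 0 i
  + (f (aL + aH) - f (2 * aL) / 2) * x 0 h
  + \sum_(i in IH :\ h)
      (f (2 * aH) - f (aL + aH) + f (2 * aL) / 2) * x 0 i <= w.

Definition higher_SI (l : 'I_n) : Prop :=
  (f (aL + aH) - f (2 * aH) / 2) * x 0 l
  + \sum_(i in IL :\ l)
      (f (2 * aL) - f (aL + aH) + f (2 * aH) / 2) * x 0 i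
  + \sum_(i in IH) f (2 * aH) / 2 * x 0 i <= w.

End Inequalities.

Definition inequality_set (R : realType) (n : nat) (f : R -> R)
    (a : 'rV[R]_n) (aL aH : R) : set (space R n) :=
  [set wx : space R n | let: (w, x) := wx in
    super_average f a aL aH w x
    /\ (forall l, l \in indices_at a aL -> lifted_EPI_low f a aL aH w x l)
    /\ (forall h, h \in indices_at a aH -> lifted_EPI_high f a aL aH w x h)
    /\ (forall h, h \in indices_at a aH -> lower_SI f a aL aH w x h)
    /\ (forall l, l \in indices_at a aL -> higher_SI f a aL aH w x l)
    /\ (forall i, 0 <= x 0 i <= 1)
    /\ \sum_(i < n) x 0 i <= 2].

(* Main.v *)
(** Distribute a point [x] over the pairs, singletons and empty set; a
  distribution using only sets on which one of the inequalities is tight shows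
  that the right-hand side of that inequality, at [x], lies in the hull.
  If [x_m] is at least the sum of the other coordinates, pair every other index
  with [m]: this is tight for the lifted-EPI of [m].  Otherwise every [x_m] is at
  most half of the total, and pairs suffice.  Any nonnegative vector none of
  whose coordinates exceeds half of their sum is a nonnegative combination of
  pairs (induction on the support).  If this condition also holds within each
  weight class, pair within the classes: super-average inequality.  If not, let
  [m] have the largest excess over the rest of its class; pair that rest with
  [m], and pair the other class together with the excess of [m]: the SI of [m] is
  tight.  Conversely, each inequality holds at singletons and pairs, which is
  where concavity and the hypothesis on [f] enter. *)

Require Import Defs.
From mathcomp Require Import all_boot all_order all_algebra.
From mathcomp Require Import all_classical all_reals all_analysis.
From mathcomp Require Import ring lra.

Set Implicit Arguments.
Unset Strict Implicit.
Unset Printing Implicit Defensive.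

Import Order.TTheory GRing.Theory Num.Theory.

Local Open Scope classical_set_scope.
Local Open Scope ring_scope.

(** * Convex hulls and the cone over a convex set *)

Section ConvexHull.
Context {R : realType} {E : lmodType R}.
Implicit Types (A : set E) (p q : E) (t u : R).

Lemma convex_setP A : @convex_set R E A <->
  forall p q t, A p -> A q -> 0 <= t <= 1 -> A (t *: p + (1 - t) *: q).
Proof.
split=> [cA p q t Ap Aq /andP[t0 t1]|cA p q t].
  have /set_mem := cA p q (Itv01 t0 t1) (mem_set Ap) (mem_set Aq).
  by [].
move=> /set_mem Ap /set_mem Aq; apply/mem_set.
by apply: cA => //; rewrite ge0 le1.
Qed.

Lemma convex_hull_convex A : @convex_set R E (convex_hull A).
Proof.
apply/convex_setP => p q t hp hq t01 C cAC.
by move/convex_setP: (cAC.1); apply => //; [apply: hp|apply: hq].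
Qed.

(** The cone over [A] placed at height 1: [t] records the mass spent, so partial distributions can
    be added without normalising. Mass 0 allows only [p = 0]. *)
Definition scaled_mem A t p : Prop := 0 <= t /\ exists2 q, A q & p = t *: q.

(** The sum is [t + u] times the average of the two underlying points with weights [t / (t + u)] and
    [u / (t + u)]. If [t + u = 0], both vectors vanish and any point of [A] serves. *)
Lemma scaled_memD A t u p q : @convex_set R E A ->
  scaled_mem A t p -> scaled_mem A u q -> scaled_mem A (t + u) (p + q).
Proof.
move=> /convex_setP cA [t0 [p' Ap' ->]] [u0 [q' Aq' ->]].
split; first exact: addr_ge0.
have [tu0|tu0] := eqVneq (t + u) 0.
  have /andP[/eqP-> /eqP->] : (t == 0) && (u == 0) by rewrite -paddr_eq0// tu0.
  by exists p'; rewrite // !addr0 !scale0r addr0.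
have tu_gt0 : 0 < t + u by rewrite lt_neqAle eq_sym tu0 addr_ge0.
exists ((t / (t + u)) *: p' + (1 - t / (t + u)) *: q').
  by apply: cA => //; rewrite divr_ge0 ?addr_ge0//= ler_pdivrMr// mul1r lerDl.
by rewrite scalerDr !scalerA; congr (_ *: _ + _ *: _); field.
Qed.

End ConvexHull.

(** * Distributing a point over pairs, singletons and the empty set *)

Section MixedBinary.
Context {R : realType} {n : nat} (f : R -> R) (a : 'rV[R]_n).
Hypothesis f0 : f 0 = 0.

Local Notation conv := (convex_hull (mixed_binary_set f a)).
Local Notation e_ i := (delta_mx 0 i : 'rV[R]_n).

Definition scaled_hull (t w : R) (x : 'rV[R]_n) : Prop :=
  @scaled_mem R (Defs.space R n) conv t (w, x).

Lemma sum_delta i (F : 'I_n -> R) : \sum_j F j * (e_ i) 0 j = F i.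
Proof.
rewrite (bigD1 i)//= mxE !eqxx mulr1 big1 ?addr0// => j ji.
by rewrite mxE eqxx (negPf ji) mulr0.
Qed.

Lemma sum_coord i : \sum_j (e_ i) 0 j = 1.
Proof.
by rewrite -[RHS](sum_delta i (fun=> 1)); apply: eq_bigr => j _; rewrite mul1r.
Qed.

(** The points whose translate by [d] lies in the hull form a convex set, and it contains the
    generators because their first coordinate is unbounded above. *)
Lemma conv_upward w v x : w <= v -> conv (w, x) -> conv (v, x).
Proof.
move=> wv; pose d : Defs.space R n := (v - w, 0).
suff : conv `<=` [set p | conv (p + d)].
  move=> /[apply]; rewrite /d /=.
  rewrite [X in conv X -> _](_ : _ = (v, x))//.
  by congr pair; rewrite ?addr0//= addrC subrK.
apply: smallest_sub.
  apply/convex_setP => p q t cp cq t01 /=.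
  rewrite [X in conv X](_ : _ = t *: (p + d) + (1 - t) *: (q + d)).
    have /convex_setP := @convex_hull_convex R (Defs.space R n)
      (mixed_binary_set f a).
    exact.
  by rewrite !scalerDr addrACA -[t *: d + _]scalerDl addrCA subrr addr0 scale1r.
move=> [u y] [fu y01 y2]; apply: sub_gen_smallest.
rewrite /mixed_binary_set/= addr0.
by split => //; rewrite (le_trans fu)// lerDl subr_ge0.
Qed.

Lemma mixed_binary_set0 : mixed_binary_set f a (0, 0).
Proof.
split => [|i|].
- by rewrite big1 ?f0// => i _; rewrite mxE mulr0.
- by left; rewrite mxE.
- by rewrite big1// => i _; rewrite mxE.
Qed.

Lemma scaled_hull0 : scaled_hull 0 0 0.
Proof.
split=> //; exists (0, 0); last by rewrite scale0r.
by apply: sub_gen_smallest; apply: mixed_binary_set0.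
Qed.

Lemma scaled_hullD t u w v x y : scaled_hull t w x -> scaled_hull u v y ->
  scaled_hull (t + u) (w + v) (x + y).
Proof. exact/scaled_memD/convex_hull_convex. Qed.

Lemma scaled_hull_sum (t w : 'I_n -> R) (x : 'I_n -> 'rV[R]_n) :
  (forall i, scaled_hull (t i) (w i) (x i)) ->
  scaled_hull (\sum_i t i) (\sum_i w i) (\sum_i x i).
Proof.
move=> h; apply: (big_ind3 scaled_hull) => //; first exact: scaled_hull0.
by move=> *; apply: scaled_hullD.
Qed.

Lemma scaled_hullZ t w x : 0 <= t -> mixed_binary_set f a (w, x) ->
  scaled_hull t (t * w) (t *: x).
Proof.
by move=> t0 wx; split=> //; exists (w, x) => //; apply: sub_gen_smallest.
Qed.

Lemma scaled_hull_empty t : 0 <= t -> scaled_hull t 0 0.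
Proof.
move=> t0; have := @scaled_hullZ t 0 0 t0; rewrite mulr0 scaler0; apply.
exact: mixed_binary_set0.
Qed.

Lemma scaled_hull_single t i : 0 <= t -> scaled_hull t (t * f (a 0 i)) (t *: e_ i).
Proof.
move=> t0; apply: scaled_hullZ => //; split => [|j|].
- by rewrite sum_delta.
- by rewrite mxE eqxx; case: eqP; [right|left].
- by rewrite sum_coord; lra.
Qed.

Lemma scaled_hull_pair t i j : 0 <= t -> i != j ->
  scaled_hull t (t * f (a 0 i + a 0 j)) (t *: (e_ i + e_ j)).
Proof.
move=> t0 ij; apply: scaled_hullZ => //; split => [|k|].
- under eq_bigr do rewrite mxE mulrDr.
  by rewrite big_split/= !sum_delta.
- rewrite !mxE eqxx/=; have [->|ki] := eqVneq k i.
    by rewrite (negPf ij); right; rewrite addr0.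
  by case: eqP => _; [right|left]; rewrite add0r.
- under eq_bigr do rewrite mxE.
  by rewrite big_split/= !sum_coord; lra.
Qed.

(** Each pair of [i] and [m] receives weight [y 0 i], so [m] collects the total of [y]. The
    degenerate term [i = m] has weight 0. *)
Lemma scaled_hull_star m (y : 'rV[R]_n) :
  (forall i, 0 <= y 0 i) -> y 0 m = 0 ->
  scaled_hull (\sum_i y 0 i) (\sum_i y 0 i * f (a 0 i + a 0 m))
    (y + (\sum_i y 0 i) *: e_ m).
Proof.
move=> y0 ym; rewrite {3}(row_sum_delta y) scaler_suml -big_split/=.
apply: scaled_hull_sum => i; rewrite -scalerDr.
have [->|im] := eqVneq i m; last exact: scaled_hull_pair.
by rewrite ym mul0r scale0r; apply: scaled_hull0.
Qed.

(** When [u 0 m] is exactly half of the total, pairing every other index with [m] exhausts all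
    coordinates at once. Here [c] is a linear form tight on the pairs inside the support of [u]. *)
Lemma scaled_hull_pairing_star (c : 'I_n -> R) (u : 'rV[R]_n) m :
  (forall i, 0 <= u 0 i) -> 2 * u 0 m = \sum_i u 0 i ->
  (forall i j, i != j -> u 0 i != 0 -> u 0 j != 0 ->
     f (a 0 i + a 0 j) = c i + c j) ->
  scaled_hull ((\sum_i u 0 i) / 2) (\sum_i c i * u 0 i) u.
Proof.
move=> u0 um fc; pose y := u - u 0 m *: e_ m.
have ym : y 0 m = 0 by rewrite !mxE !eqxx mulr1 subrr.
have yE i : i != m -> y 0 i = u 0 i.
  by move=> im; rewrite !mxE eqxx (negPf im) mulr0 subr0.
have y0 i : 0 <= y 0 i by have [->|/yE->] := eqVneq i m; rewrite ?ym.
have sy : \sum_i y 0 i = u 0 m.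
  rewrite (bigD1 m)//= ym add0r (eq_bigr (fun i => u 0 i)); last by move=> i /yE.
  by move: um; rewrite (bigD1 m)//=; lra.
have := scaled_hull_star y0 ym.
rewrite sy subrK -um mulrAC divff ?pnatr_eq0// mul1r.
congr scaled_hull.
rewrite (bigD1 m)//= ym mul0r add0r [RHS](bigD1 m)//= -sy mulr_sumr.
rewrite [X in _ = X + _](bigD1 m)//= ym mulr0 add0r -big_split/=.
apply: eq_bigr => i im; rewrite yE//.
have [->|ui] := eqVneq (u 0 i) 0; first by rewrite mul0r !mulr0 addr0.
rewrite fc//; first by ring.
(* If [u 0 m] were 0, the whole sum would be 0, hence [u 0 i] too. *)
apply: contra_neq ui => um0; apply/le_anti; rewrite u0 andbT.
rewrite -[leRHS](mulr0 2) -um0 um (bigD1 i)//= lerDl.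
by apply: sumr_ge0.
Qed.

Lemma scaled_hull_pairing (c : 'I_n -> R) (u : 'rV[R]_n) :
  (forall i, 0 <= u 0 i) -> (forall i, 2 * u 0 i <= \sum_j u 0 j) ->
  (forall i j, i != j -> u 0 i != 0 -> u 0 j != 0 ->
     f (a 0 i + a 0 j) = c i + c j) ->
  scaled_hull ((\sum_i u 0 i) / 2) (\sum_i c i * u 0 i) u.
Proof.
have [k] := ubnP #|[set i | u 0 i != 0]%SET|.
elim: k u => // k IH u; rewrite ltnS => suppu u0 uS fc.
have [->|/rV0Pn[i ui]] := eqVneq u 0.
  rewrite !big1 ?mul0r; [exact: scaled_hull0|move=> i _..]; rewrite mxE ?mulr0//.
have ui_gt0 : 0 < u 0 i by rewrite lt_neqAle eq_sym ui u0.
(* With [i] alone in the support, [u 0 i] would be the whole sum, against the half bound. *)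
have [j ji uj] : exists2 j, j != i & u 0 j != 0.
  apply: contrapT => nj; have := uS i.
  rewrite (bigD1 i)//= big1 => [|j ji]; first lra.
  by apply/eqP; apply: contrapT => /negP uj; apply: nj; exists j.
have uj_gt0 : 0 < u 0 j by rewrite lt_neqAle eq_sym uj u0.
pose v e := u - e *: (e_ i + e_ j).
have viE e : v e 0 i = u 0 i - e.
  by rewrite !mxE !eqxx [i == j]eq_sym (negPf ji)/= addr0 mulr1.
have vjE e : v e 0 j = u 0 j - e.
  by rewrite !mxE !eqxx (negPf ji)/= add0r mulr1.
have vE e l : l != i -> l != j -> v e 0 l = u 0 l.
  by move=> li lj; rewrite !mxE eqxx (negPf li) (negPf lj)/= addr0 mulr0 subr0.
have sv (d : 'I_n -> R) e :
    \sum_l d l * v e 0 l = \sum_l d l * u 0 l - e * (d i + d j).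
  rewrite -(sum_delta i d) -(sum_delta j d) -big_split/= mulr_sumr -sumrB.
  by apply: eq_bigr => l _; rewrite !mxE; ring.
have sv1 e : \sum_l v e 0 l = \sum_l u 0 l - 2 * e.
  have := sv (fun=> 1) e; rewrite -!mulr_sumr !mul1r => ->; ring.
have step e : 0 <= e ->
    scaled_hull ((\sum_l v e 0 l) / 2) (\sum_l c l * v e 0 l) (v e) ->
    scaled_hull ((\sum_l u 0 l) / 2) (\sum_l c l * u 0 l) u.
  move=> e0 hv.
  have hij := scaled_hull_pair e0 ji.
  have := scaled_hullD hv hij; rewrite fc//.
  rewrite sv sv1 /v [e_ j + _]addrC subrK.
  by congr scaled_hull; field.
(* The largest weight that the pair of [i] and [j] can take; it removes one of the two from the
   support. *)
pose e0 := Num.min (u 0 i) (u 0 j).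
have e0_ge0 : 0 <= e0 by rewrite le_min !u0.
have v_ge0 e : 0 <= e <= e0 -> forall l, 0 <= v e 0 l.
  rewrite le_min => /and3P[e_ge0 ei ej] l.
  have [->|li] := eqVneq l i; first by rewrite viE subr_ge0.
  have [->|lj] := eqVneq l j; first by rewrite vjE subr_ge0.
  by rewrite vE.
have supp_v e l : v e 0 l != 0 -> u 0 l != 0.
  have [->//|li] := eqVneq l i.
  have [->//|lj] := eqVneq l j.
  by rewrite vE.
have fcv e l m : l != m -> v e 0 l != 0 -> v e 0 m != 0 ->
    f (a 0 l + a 0 m) = c l + c m.
  by move=> lm /supp_v ul /supp_v um; apply: fc.
(* At [i] and [j] both sides of the half bound drop by [2 * e0]; only a third index can come to
   violate it. *)
have [le_e0|] := boolP [forall l, (l != i) && (l != j) ==>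
    (2 * (u 0 l + e0) <= \sum_l u 0 l)].
  apply: (step e0) => //; apply: IH.
  - apply: leq_trans suppu; apply: proper_card; apply/properP; split.
      by apply/fintype.subsetP => l; rewrite !inE; apply: supp_v.
    have [uij|uji] := leP (u 0 i) (u 0 j).
      by exists i; rewrite !inE// viE /e0 min_l// subrr eqxx.
    by exists j; rewrite !inE// vjE /e0 min_r ?subrr ?eqxx// ltW.
  - by apply: v_ge0; rewrite e0_ge0 lexx.
  - move=> l; rewrite sv1.
    have [->|li] := eqVneq l i; first by rewrite viE; have := uS i; lra.
    have [->|lj] := eqVneq l j; first by rewrite vjE; have := uS j; lra.
    by move/forallP: le_e0 => /(_ l); rewrite li lj vE//=; lra.
  - exact: fcv.
rewrite negb_forall => /existsP[l]; rewrite negb_imply => /andP[/andP[li lj]].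
rewrite -ltNge => lt_e0.
(* The weight at which the half bound at [l] becomes an equality. It is below [e0] because [e0]
   breaks that bound, and the star at [l] then finishes without induction. *)
pose e := (\sum_l u 0 l) / 2 - u 0 l.
have e_ge0 : 0 <= e by rewrite /e; have := uS l; lra.
apply: (step e) => //; apply: (@scaled_hull_pairing_star _ _ l).
- by apply: v_ge0; rewrite e_ge0 /e; lra.
- by rewrite sv1 vE// /e; lra.
- exact: fcv.
Qed.

End MixedBinary.

(** * The inequalities in a form common to both weight classes *)

Section TwoWeights.
Context {R : realType} {n : nat} (f : R -> R) (a : 'rV[R]_n) (aL aH : R).
Hypothesis aL_lt_aH : aL < aH.
Hypothesis a_values : forall i, a 0 i = aL \/ a 0 i = aH.

Local Notation IL := (indices_at a aL).
Local Notation IH := (indices_at a aH).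
Local Notation other m := (aL + aH - a 0 m).

(* All four families besides the super-average inequality are
   [\sum_i star_coef m s i * x_i <= w]: the pairs containing [m] are tight, and
   [s = f (a_m)] gives the lifted-EPIs, [s = SI_shift m] the lower- and
   higher-SIs. *)
Definition star_coef m s i : R := if i == m then s else f (a 0 i + a 0 m) - s.

Definition SI_shift m : R := f (aL + aH) - f (2 * other m) / 2.

Lemma sum_low_high (F : 'I_n -> R) :
  \sum_i F i = \sum_(i in IL) F i + \sum_(i in IH) F i.
Proof.
rewrite (bigID (fun i => a 0 i == aL))/=; congr (_ + _); apply: eq_bigl => i.
  by rewrite inE.
rewrite inE; have [->|->] := a_values i; first by rewrite eqxx lt_eqF.
by rewrite eqxx gt_eqF.
Qed.

Lemma sum_low (F : 'I_n -> R) l : l \in IL ->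
  \sum_i F i = F l + \sum_(i in IL :\ l) F i + \sum_(i in IH) F i.
Proof. by move=> lL; rewrite sum_low_high (big_setD1 l lL). Qed.

Lemma sum_high (F : 'I_n -> R) h : h \in IH ->
  \sum_i F i = F h + \sum_(i in IL) F i + \sum_(i in IH :\ h) F i.
Proof. by move=> hH; rewrite sum_low_high (big_setD1 h hH)//= addrCA addrA. Qed.


Lemma super_averageE w x :
  super_average f a aL aH w x = (\sum_i f (2 * a 0 i) / 2 * x 0 i <= w).
Proof.
rewrite /super_average sum_low_high; congr (is_true (_ + _ <= _)).
  by apply: eq_bigr => i; rewrite inE => /eqP ->.
by apply: eq_bigr => i; rewrite inE => /eqP ->.
Qed.

Lemma lifted_EPI_lowE w x l : l \in IL ->
  lifted_EPI_low f a aL aH w x l =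
  (\sum_i star_coef l (f (a 0 l)) i * x 0 i <= w).
Proof.
move=> lL; rewrite /lifted_EPI_low (sum_low _ lL) /star_coef eqxx.
have al : a 0 l = aL by move: lL; rewrite inE => /eqP.
congr (is_true (_ + _ + _ <= _)); first by rewrite al.
  apply: eq_bigr => i; rewrite !inE => /andP[/negPf -> /eqP ->].
  by rewrite al mulr_natl mulr2n.
apply: eq_bigr => i; rewrite inE => /eqP ai.
have [il|_] := eqVneq i l; last by rewrite al ai [aH + _]addrC.
by move: aL_lt_aH; rewrite -al -ai il ltxx.
Qed.

Lemma lifted_EPI_highE w x h : h \in IH ->
  lifted_EPI_high f a aL aH w x h =
  (\sum_i star_coef h (f (a 0 h)) i * x 0 i <= w).
Proof.
move=> hH; rewrite /lifted_EPI_high (sum_high _ hH) /star_coef eqxx.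
have ah : a 0 h = aH by move: hH; rewrite inE => /eqP.
congr (is_true (_ + _ + _ <= _)); first by rewrite ah.
  apply: eq_bigr => i; rewrite inE => /eqP ai.
  have [ih|_] := eqVneq i h; last by rewrite ah ai.
  by move: aL_lt_aH; rewrite -ah -ai ih ltxx.
apply: eq_bigr => i; rewrite !inE => /andP[/negPf -> /eqP ->].
by rewrite ah mulr_natl mulr2n.
Qed.

Lemma lower_SIE w x h : h \in IH ->
  lower_SI f a aL aH w x h =
  (\sum_i star_coef h (SI_shift h) i * x 0 i <= w).
Proof.
move=> hH; rewrite /lower_SI (sum_high _ hH) /star_coef /SI_shift eqxx.
have ah : a 0 h = aH by move: hH; rewrite inE => /eqP.
rewrite ah addrK [X in _ = is_true (X + _ <= _)]addrC.
congr (is_true (_ + _ + _ <= _)).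
  apply: eq_bigr => i; rewrite inE => /eqP ai.
  have [ih|_] := eqVneq i h; last by rewrite ai subKr.
  by move: aL_lt_aH; rewrite -ah -ai ih ltxx.
apply: eq_bigr => i; rewrite !inE => /andP[/negPf -> /eqP ->].
by rewrite mulr_natl mulr2n opprB addrA addrAC.
Qed.

Lemma higher_SIE w x l : l \in IL ->
  higher_SI f a aL aH w x l =
  (\sum_i star_coef l (SI_shift l) i * x 0 i <= w).
Proof.
move=> lL; rewrite /higher_SI (sum_low _ lL) /star_coef /SI_shift eqxx.
have al : a 0 l = aL by move: lL; rewrite inE => /eqP.
rewrite al [aL + aH]addrC addrK; congr (is_true (_ + _ + _ <= _)).
  apply: eq_bigr => i; rewrite !inE => /andP[/negPf -> /eqP ->].
  by rewrite mulr_natl mulr2n opprB addrA addrAC.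
apply: eq_bigr => i; rewrite inE => /eqP ai.
have [il|_] := eqVneq i l; last by rewrite ai subKr.
by move: aL_lt_aH; rewrite -al -ai il ltxx.
Qed.

Lemma inequality_setE w x : inequality_set f a aL aH (w, x) <->
  [/\ \sum_i f (2 * a 0 i) / 2 * x 0 i <= w,
      forall m, \sum_i star_coef m (f (a 0 m)) i * x 0 i <= w,
      forall m, \sum_i star_coef m (SI_shift m) i * x 0 i <= w,
      forall i, 0 <= x 0 i <= 1
    & \sum_i x 0 i <= 2].
Proof.
have LH m : m \in IL \/ m \in IH.
  by have [am|am] := a_values m; [left|right]; rewrite inE am.
rewrite /inequality_set/= super_averageE; split.
  move=> [avg [El [Eh [Sh [Sl [x01 x2]]]]]]; split=> // m.
    by have [mL|mH] := LH m; [rewrite -lifted_EPI_lowE//; apply: El|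
                              rewrite -lifted_EPI_highE//; apply: Eh].
  by have [mL|mH] := LH m; [rewrite -higher_SIE//; apply: Sl|
                            rewrite -lower_SIE//; apply: Sh].
move=> [avg E S x01 x2]; split=> //; split; last split; last split; last split=> //.
- by move=> l lL; rewrite lifted_EPI_lowE.
- by move=> h hH; rewrite lifted_EPI_highE.
- by move=> h hH; rewrite lower_SIE.
- by move=> l lL; rewrite higher_SIE.
Qed.

(** * Points where an inequality is tight, as convex combinations *)

Section ConvexCombinations.
Hypothesis f0 : f 0 = 0.
Variable x : 'rV[R]_n.
Hypotheses (x_ge0 : forall i, 0 <= x 0 i) (x_le2 : \sum_i x 0 i <= 2).

Local Notation conv := (convex_hull (mixed_binary_set f a)).
Local Notation class_sum i := (\sum_(j | a 0 j == a 0 i) x 0 j).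

Lemma conv_scaled_hull w : scaled_hull f a 1 w x -> conv (w, x).
Proof. by case=> _ [q cq]; rewrite scale1r => ->. Qed.

(** The weights are [x 0 i] on the pair of [i] and [m], [2 * x 0 m - \sum_i x 0 i] on the singleton
    of [m], and [1 - x 0 m] on the empty set. The two hypotheses make the last two nonnegative, and
    the total is 1. *)
Lemma conv_EPI m : x 0 m <= 1 -> \sum_i x 0 i <= 2 * x 0 m ->
  conv (\sum_i star_coef m (f (a 0 m)) i * x 0 i, x).
Proof.
move=> xm1 xm; apply: conv_scaled_hull.
pose y := x - x 0 m *: delta_mx 0 m.
have ym : y 0 m = 0 by rewrite !mxE !eqxx mulr1 subrr.
have yE i : i != m -> y 0 i = x 0 i.
  by move=> im; rewrite !mxE eqxx (negPf im) mulr0 subr0.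
have y0 i : 0 <= y 0 i by have [->|/yE->] := eqVneq i m; rewrite ?ym.
have sy : \sum_i y 0 i = \sum_i x 0 i - x 0 m.
  rewrite (bigD1 m)//= [X in _ = X - _](bigD1 m)//= ym add0r [x 0 m + _]addrC addrK.
  by apply: eq_bigr => i /yE.
have h1 := scaled_hull_star a f0 y0 ym.
have t0 : 0 <= 2 * x 0 m - \sum_i x 0 i by rewrite subr_ge0.
have h2 := scaled_hull_single f a m t0.
have h3 : scaled_hull f a (1 - x 0 m) 0 0 by apply: scaled_hull_empty => //; lra.
have := scaled_hullD h1 (scaled_hullD h2 h3).
rewrite sy; congr scaled_hull; first by ring.
  rewrite addr0 [RHS](bigD1 m)//= (bigD1 m)//= ym mul0r add0r.
  have -> : star_coef m (f (a 0 m)) m = f (a 0 m) by rewrite /star_coef eqxx.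
  rewrite (eq_bigr (fun i => f (a 0 i + a 0 m) * x 0 i)); last first.
    by move=> i im; rewrite yE// mulrC.
  rewrite [in RHS](eq_bigr
    (fun i => f (a 0 i + a 0 m) * x 0 i - f (a 0 m) * x 0 i)).
    by rewrite sumrB -mulr_sumr [\sum_i x 0 i](bigD1 m)//=; ring.
  by move=> i im; rewrite /star_coef (negPf im) mulrBl.
apply/rowP => i; rewrite !mxE; ring.
Qed.

Lemma conv_average : (forall i, 2 * x 0 i <= class_sum i) ->
  conv (\sum_i f (2 * a 0 i) / 2 * x 0 i, x).
Proof.
move=> xS; apply: conv_scaled_hull.
(* Restricting the support to one class admits only pairs of equal weights, on which the
   super-average coefficients are tight. The empty set absorbs the remaining mass
   [1 - (\sum_i x 0 i) / 2]. *)
pose part b : 'rV[R]_n := \row_i (if a 0 i == b then x 0 i else 0).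
have hpart b : scaled_hull f a ((\sum_i part b 0 i) / 2)
    (\sum_i f (2 * a 0 i) / 2 * part b 0 i) (part b).
  apply: scaled_hull_pairing => // [i|i|i j ij].
  - by rewrite mxE; case: ifP.
  - under eq_bigr do rewrite mxE.
    rewrite -big_mkcond/= mxE; case: eqP => [<-//|_].
    by rewrite mulr0 sumr_ge0.
  - rewrite !mxE; have [->|_] := eqVneq (a 0 i) b; last by rewrite eqxx.
    have [->|_] := eqVneq (a 0 j) b; last by rewrite eqxx.
    by move=> _ _; rewrite -splitr mulr_natl mulr2n.
have xE i : part aL 0 i + part aH 0 i = x 0 i.
  rewrite !mxE; have [->|->] := a_values i.
    by rewrite eqxx lt_eqF// addr0.
  by rewrite eqxx gt_eqF// add0r.
have h0 : scaled_hull f a (1 - (\sum_i x 0 i) / 2) 0 0.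
  by apply: scaled_hull_empty => //; move: x_le2; lra.
have := scaled_hullD (scaled_hullD (hpart aL) (hpart aH)) h0.
congr scaled_hull.
- by rewrite -mulrDl -big_split/= (eq_bigr _ (fun i _ => xE i)); ring.
- rewrite addr0 -big_split/=; apply: eq_bigr => i _.
  by rewrite -mulrDr xE.
- by rewrite addr0; apply/rowP => i; rewrite mxE xE.
Qed.

Lemma conv_SI m : (forall i, 2 * x 0 i <= \sum_j x 0 j) ->
  class_sum m <= 2 * x 0 m ->
  (forall i, 2 * x 0 i - class_sum i <= 2 * x 0 m - class_sum m) ->
  conv (\sum_i star_coef m (SI_shift m) i * x 0 i, x).
Proof.
move=> xS m_ge0 m_max; apply: conv_scaled_hull.
(* [r] is the excess of [m], [y] the rest of its class, [z] the opposite class. The star at [m]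
   covers [y] and uses all of [x 0 m] but [r]; [u] is what remains to be paired. *)
set s := SI_shift m; pose r := 2 * x 0 m - class_sum m.
pose y : 'rV[R]_n := \row_i (if (i != m) && (a 0 i == a 0 m) then x 0 i else 0).
pose z : 'rV[R]_n := \row_i (if a 0 i == a 0 m then 0 else x 0 i).
pose u := z + r *: delta_mx 0 m.
pose c i := if i == m then s else f (2 * other m) / 2.
have ym : y 0 m = 0 by rewrite mxE eqxx.
have zm : z 0 m = 0 by rewrite mxE eqxx.
have um : u 0 m = r by rewrite mxE zm add0r !mxE !eqxx mulr1.
have uE i : i != m -> u 0 i = z 0 i.
  by move=> im; rewrite !mxE eqxx (negPf im) mulr0 addr0.
have xE i : i != m -> x 0 i = y 0 i + z 0 i.
  by move=> im; rewrite !mxE im; case: eqP; rewrite ?addr0 ?add0r.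
have sm : class_sum m = x 0 m + \sum_i y 0 i.
  rewrite (bigD1 m)//=; congr (_ + _).
  under [RHS]eq_bigr do rewrite mxE.
  by rewrite -big_mkcond/=; under eq_bigl do rewrite andbC.
have sx : \sum_i x 0 i = x 0 m + \sum_i y 0 i + \sum_i z 0 i.
  rewrite (bigD1 m)//= -addrA -big_split/= [in RHS](bigD1 m)//= ym zm !add0r.
  by congr (_ + _); apply: eq_bigr => i /xE.
have su : \sum_i u 0 i = r + \sum_i z 0 i.
  rewrite (bigD1 m)//= um [in RHS](bigD1 m)//= zm add0r.
  by congr (_ + _); apply: eq_bigr => i /uE.
have other_class i : a 0 i != a 0 m ->
    class_sum i = \sum_j z 0 j /\ a 0 i = other m.
  move=> im; split.
    under [RHS]eq_bigr do rewrite mxE -if_neg.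
    rewrite -big_mkcond/=; apply: eq_bigl => j.
    move: im; have [->|->] := a_values i; have [->|->] := a_values j;
      have [->|->] := a_values m;
      rewrite ?eqxx ?(lt_eqF aL_lt_aH) ?(gt_eqF aL_lt_aH)//.
  move: im; have [->|->] := a_values i; have [->|->] := a_values m;
    by rewrite ?eqxx// => _; ring.
have y_ge0 i : 0 <= y 0 i by rewrite mxE; case: ifP.
have hy := scaled_hull_star a f0 y_ge0 ym.
have hu : scaled_hull f a ((\sum_i u 0 i) / 2) (\sum_i c i * u 0 i) u.
  apply: scaled_hull_pairing => // [i|i|i j].
  - have [->|/uE->] := eqVneq i m; first by rewrite um subr_ge0.
    by rewrite mxE; case: ifP.
  (* The half bound for [u] at [m] comes from the one for [x]; at an index of the opposite class it
     is the maximality of the excess of [m]. *)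
  - rewrite su; have [->|im] := eqVneq i m.
      by rewrite um; have := xS m; rewrite sx /r sm; lra.
    rewrite uE// mxE; case: eqP => [_|/eqP ai].
      rewrite mulr0 addr_ge0 ?subr_ge0// sumr_ge0// => j _.
      by rewrite mxE; case: ifP.
    by have := m_max i; rewrite (other_class _ ai).1 /r; lra.
  (* Apart from [m], the support of [u] lies in the opposite class, so only mixed pairs with [m] and
     pairs within that class need be tight. *)
  - have nz k : k != m -> u 0 k != 0 -> a 0 k = other m.
      move=> /uE ->; rewrite mxE.
      have [_|/other_class[]//] := eqVneq (a 0 k) (a 0 m).
      by rewrite eqxx.
    have cm : c m = s by rewrite /c eqxx.
    have cE k : k != m -> c k = f (2 * other m) / 2 by rewrite /c => /negPf ->.
    have pm : f (other m + a 0 m) = s + f (2 * other m) / 2 by rewrite !subrK.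
    have [->|im] := eqVneq i m.
      rewrite eq_sym => jm _ uj.
      by rewrite cm cE// (nz j)// [a 0 m + _]addrC pm.
    have [->|jm] := eqVneq j m.
      by move=> _ ui _; rewrite cm cE// (nz i)// pm addrC.
    by move=> _ ui uj; rewrite !cE// (nz i)// (nz j)// -splitr mulr_natl mulr2n.
have h0 : scaled_hull f a (1 - (\sum_i x 0 i) / 2) 0 0.
  by apply: scaled_hull_empty => //; move: x_le2; lra.
have := scaled_hullD (scaled_hullD hy hu) h0.
congr scaled_hull.
- by rewrite su sx /r sm; field.
- rewrite addr0 (bigD1 m)//= ym mul0r add0r [X in _ + X](bigD1 m)//= um.
  rewrite [RHS](bigD1 m)//= /c /star_coef !eqxx.
  have -> : r = x 0 m - \sum_(i | i != m) y 0 i.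
    by rewrite /r sm (bigD1 m)//= ym; ring.
  rewrite mulrBr mulr_sumr addrCA -addrA; congr (_ + _).
  rewrite addrCA addrC -sumrN -!big_split/=; apply: eq_bigr => i im.
  rewrite (negPf im) uE// xE// !mxE im/=.
  case: eqP => [ai|/eqP /other_class[_ ai]].
    by ring.
  by rewrite ai /s /SI_shift subrK; ring.
- rewrite addr0; apply/rowP => i; rewrite /u !mxE; have [->|im]/= := eqVneq i m.
    by rewrite ?eqxx /r sm; ring.
  by rewrite ?eqxx; case: ifP => _; ring.
Qed.

End ConvexCombinations.

Lemma inequality_set_sub_hull (f0 : f 0 = 0) (i0 : 'I_n) :
  inequality_set f a aL aH `<=` convex_hull (mixed_binary_set f a).
Proof.
move=> [w x] /inequality_setE[avg EPI SI x01 x2].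
have x0 i : 0 <= x 0 i by have /andP[] := x01 i.
have [/existsP[m xm]|/existsPn xs] := boolP [exists m, \sum_i x 0 i <= 2 * x 0 m].
  apply: (conv_upward (EPI m)); apply: conv_EPI => //.
  by have /andP[] := x01 m.
have {}xs i : 2 * x 0 i <= \sum_j x 0 j by rewrite ltW// ltNge xs.
pose excess i := 2 * x 0 i - \sum_(j | a 0 j == a 0 i) x 0 j.
have [m _ m_max] := @arg_maxP _ _ _ i0 predT excess isT.
(* A nonpositive maximal excess is the half bound within every class. *)
have [m_le0|/ltW m_ge0] := leP (excess m) 0.
  apply: (conv_upward avg); apply: conv_average => // i.
  by rewrite -subr_le0; apply: le_trans m_le0; apply: m_max.
apply: (conv_upward (SI m)); apply: conv_SI => //.
- by rewrite -subr_ge0.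
- by move=> i; apply: m_max.
Qed.

(** * The reverse inclusion: convexity and validity at the generators *)

Lemma inequality_set_convex :
  @convex_set R (Defs.space R n) (inequality_set f a aL aH).
Proof.
have lin (c : 'I_n -> R) t (x y : 'rV[R]_n) :
    \sum_i c i * (t *: x + (1 - t) *: y) 0 i =
    t * (\sum_i c i * x 0 i) + (1 - t) * (\sum_i c i * y 0 i).
  by rewrite !mulr_sumr -big_split/=; apply: eq_bigr => i _; rewrite !mxE; ring.
apply/convex_setP => -[w x] [v y] t.
move=> /inequality_setE[avgx EPIx SIx x01 x2].
move=> /inequality_setE[avgy EPIy SIy y01 y2] /andP[t0 t1].
have t1' : 0 <= 1 - t by rewrite subr_ge0.
have cvx (p q p' q' : R) : p <= p' -> q <= q' ->
    t * p + (1 - t) * q <= t * p' + (1 - t) * q'.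
  by move=> pp qq; rewrite lerD// ler_wpM2l.
apply/inequality_setE; split.
- by rewrite lin cvx.
- by move=> m; rewrite lin cvx.
- by move=> m; rewrite lin cvx.
- move=> i; rewrite !mxE; have /andP[? ?] := x01 i; have /andP[? ?] := y01 i.
  apply/andP; split; first by rewrite addr_ge0// mulr_ge0.
  by rewrite [leRHS](_ : _ = t * 1 + (1 - t) * 1) ?cvx//; ring.
- have := lin (fun=> 1) t x y; rewrite -!mulr_sumr !mul1r => ->.
  by rewrite [leRHS](_ : _ = t * 2 + (1 - t) * 2) ?cvx//; ring.
Qed.

Lemma concave_functionP : concave_function f -> forall t x y, 0 <= t <= 1 ->
  t * f x + (1 - t) * f y <= f (t * x + (1 - t) * y).
Proof.
move=> fc t x y /andP[t0 t1].
have := fc (Itv01 t0 t1) x y (mem_set I) (mem_set I).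
rewrite convRE/= !mulrN -opprD lerN2.
exact.
Qed.

(** A binary point is the indicator of a set of at most two indices, so only the empty set,
    singletons and pairs need checking. *)
Lemma mixed_binary_le (c : 'I_n -> R) w x : f 0 = 0 ->
  (forall i, c i <= f (a 0 i)) ->
  (forall i j, i != j -> c i + c j <= f (a 0 i + a 0 j)) ->
  mixed_binary_set f a (w, x) -> \sum_i c i * x 0 i <= w.
Proof.
move=> f0 c1 c2 [fw x01 x2]; apply: le_trans fw.
pose T := [set i | x 0 i == 1]%SET.
have sumT (d : 'I_n -> R) : \sum_i d i * x 0 i = \sum_(i in T) d i.
  rewrite [RHS]big_mkcond/=; apply: eq_bigr => i _; rewrite inE.
  have [->|->] := x01 i; last by rewrite eqxx mulr1.
  by rewrite mulr0 eq_sym oner_eq0.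
have : (#|T| <= 2)%N.
  rewrite -(ler_nat R) -sumr_const -sumT.
  by under eq_bigr do rewrite mul1r.
rewrite !sumT leq_eqVlt ltnS leq_eqVlt ltnS leqn0.
move=> /or3P[/cards2P[i [j [ij ->]]]|/cards1P[i ->]|].
- by rewrite !big_setU1 ?inE//= !big_set1 c2.
- by rewrite !big_set1.
- by rewrite cards_eq0 => /eqP ->; rewrite !big_set0 f0.
Qed.

End TwoWeights.

Theorem theorem5p13 (R : realType) (n : nat) (f : R -> R)
    (f_concave : concave_function f) (f0 : f 0 = 0)
    (a : 'rV[R]_n) (aL aH : R) (aL_ge0 : 0 <= aL) (aL_lt_aH : aL < aH)
    (a_values : forall i, a 0 i = aL \/ a 0 i = aH)
    (aL_attained : exists i, a 0 i = aL) (aH_attained : exists i, a 0 i = aH)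
    (hyp : f (aL + aH) - f aL <= f (2 * aH) / 2) :
  inequality_set f a aL aH = convex_hull (mixed_binary_set f a).
Proof.
have [i0 _] := aL_attained.
apply/seteqP; split; first exact: inequality_set_sub_hull.
apply: smallest_sub; first exact: inequality_set_convex.
have half (x y : R) : f x / 2 + f y / 2 <= f ((x + y) / 2).
  have h01 : 0 <= (2^-1 : R) <= 1 by lra.
  have := concave_functionP f_concave x y h01.
  have -> : 1 - 2^-1 = 2^-1 :> R by field.
  by rewrite -!mulrDr -mulrDl mulrC [_^-1 * (x + y)]mulrC.
have twice x : f (2 * x) <= 2 * f x.
  by have := half 0 (2 * x); rewrite f0 add0r mulrAC divff// mul1r; lra.
have twiceL := twice aL; have twiceH := twice aH.
have mid : f (2 * aL) + f (2 * aH) <= 2 * f (aL + aH).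
  have := half (2 * aL) (2 * aH).
  by rewrite -mulrDr mulrAC divff// mul1r; lra.
(* Both [2 * aL] and [aH] lie between [aL] and [aL + aH] and have the same sum as these endpoints.
   Their barycentric weights are complementary, with ratio [aL / aH], so the two concavity bounds
   add up to the claim. *)
have incr : f (aL + aH) + f aL <= f (2 * aL) + f aH.
  have aH_gt0 : 0 < aH by rewrite (le_lt_trans aL_ge0).
  have r01 : 0 <= aL / aH <= 1.
    by rewrite divr_ge0 ?(ltW aH_gt0)//= ler_pdivrMr// mul1r ltW.
  have r01' : 0 <= 1 - aL / aH <= 1 by move: r01; lra.
  have := concave_functionP f_concave aL (aL + aH) r01.
  have := concave_functionP f_concave aL (aL + aH) r01'.
  have -> : (1 - aL / aH) * aL + (1 - (1 - aL / aH)) * (aL + aH) = 2 * aL.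
    by field; rewrite gt_eqF.
  have -> : aL / aH * aL + (1 - aL / aH) * (aL + aH) = aH.
    by field; rewrite gt_eqF.
  lra.
have LL : aL + aL = 2 * aL by ring.
have HH : aH + aH = 2 * aH by ring.
have HL : aH + aL = aL + aH by ring.
have oL : aL + aH - aL = aH by ring.
have oH : aL + aH - aH = aL by ring.
(* Normalises the arguments of [f], whose values are atoms for [lra]. *)
have rw := (LL, HH, HL, oL, oH).
(* Pairs containing [m] hold with equality; the premises treat the singleton of [m], the other
   singletons, and the pairs avoiding [m]. *)
have starP m s w x : s <= f (a 0 m) ->
    (forall i, f (a 0 i + a 0 m) - s <= f (a 0 i)) ->
    (forall i j,
       f (a 0 i + a 0 m) + f (a 0 j + a 0 m) <= 2 * s + f (a 0 i + a 0 j)) ->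
    mixed_binary_set f a (w, x) -> \sum_i star_coef f a m s i * x 0 i <= w.
  move=> sm s1 s2; apply: mixed_binary_le => // [i|i j]; rewrite /star_coef.
    by case: eqP => [->|_].
  have [->|im] := eqVneq i m; have [->|jm] := eqVneq j m => ij.
  - by move: ij; rewrite ?eqxx.
  - by rewrite [a 0 m + _]addrC; lra.
  - lra.
  - by have := s2 i j; lra.
move=> [w x] wx; apply/inequality_setE => //; split.
- apply: mixed_binary_le wx => // [i|i j _].
    by have := twice (a 0 i); lra.
  by have [->|->] := a_values i; have [->|->] := a_values j; rewrite ?rw; lra.
(* For [m] low and [i], [j] high, the pair condition is exactly [hyp]. *)
- move=> m; apply: starP wx => // [i|i j].
    have [->|->] := a_values i; have [->|->] := a_values m; rewrite ?rw; lra.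
  by have [->|->] := a_values i; have [->|->] := a_values j;
    have [->|->] := a_values m; rewrite ?rw; lra.
(* For [m] low, the bound at its own singleton is again [hyp]; the pairs avoiding [m] rest on
   [mid]. *)
- rewrite /SI_shift => m; apply: starP wx => // [|i|i j].
  + have [->|->] := a_values m; rewrite ?rw; lra.
  + have [->|->] := a_values i; have [->|->] := a_values m; rewrite ?rw; lra.
  + by have [->|->] := a_values i; have [->|->] := a_values j;
      have [->|->] := a_values m; rewrite ?rw; lra.
- by move: wx => [_ x01 _] i; have [->|->] := x01 i; rewrite ?lexx ler01.
- by move: wx => [].
Qed.
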